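(* Let $1<p<\infty$ and let $H:\mathbb{R}^N\to[0,+\infty)$ be a convex positively $p$-homogeneous function. For every $0<\beta\le p-1$ the function \[ (m,\phi)\mapsto \frac{H(\phi)}{m^{\beta}},\qquad (m,\phi)\in(0,+\infty)\times\mathbb{R}^N, \] is (jointly) convex on $(0,+\infty)\times\mathbb{R}^N$.
   Context: $H$ is positively $p$-homogeneous if $H(\lambda z)=\lambda^p H(z)$ for all $z\in\mathbb{R}^N$ and all real $\lambda\ge 0$ ($H$ is not assumed to be even). *)

(* Defs.v *)
From mathcomp Require Import all_boot all_order all_algebra.
From mathcomp Require Import all_classical all_reals all_analysis.

Set Implicit Arguments.
Unset Strict Implicit.
Unset Printing Implicit Defensive.

Import Order.TTheory GRing.Theory Num.Theory.
Local Open Scope classical_set_scope.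
Local Open Scope ring_scope.

(* For p > 0 the case l = 0 gives H 0 = 0, since 0 `^ p = 0. *)
Definition positively_homogeneous (R : realType) (V : lmodType R) (p : R)
    (H : V -> R) : Prop :=
  forall (l : R) (z : V), 0 <= l -> H (l *: z) = l `^ p * H z.

(* Main.v *)
(* With [g := beta / (p - 1) <= 1], one has [H phi / m `^ beta =
   H phi / w `^ (p - 1)] for [w := m `^ g].  By homogeneity
   [H phi / w `^ (p - 1)] is the perspective [w * H (phi / w)] of the convex
   function [H], hence jointly convex in [(w, phi)]; it is nonincreasing in [w],
   and [m `^ g] is concave in [m]. *)
Require Import Defs.
From mathcomp Require Import all_boot all_order all_algebra.
From mathcomp Require Import all_classical all_reals all_analysis.
From mathcomp Require Import unstable ring.

Set Implicit Arguments.
Unset Strict Implicit.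
Unset Printing Implicit Defensive.

Import Order.TTheory GRing.Theory Num.Theory.
Local Open Scope classical_set_scope.
Local Open Scope ring_scope.

(** Since [z = w *: (w^-1 *: z)], homogeneity takes the factor [w]^ p = w * w [^ (p - 1)] out of
    [H z]. *)
Lemma perspective_homogeneous (R : realType) (V : lmodType R) (p : R)
    (H : V -> R) (w : R) (z : V) : positively_homogeneous p H -> 0 < w ->
  w * H (w^-1 *: z) = H z / w `^ (p - 1).
Proof.
move=> Hhom w0; have wp0 : w `^ (p - 1) != 0 by rewrite gt_eqF// powR_gt0.
have Hw : H z = w * w `^ (p - 1) * H (w^-1 *: z).
  rewrite -{1}(powRr1 (ltW w0)) -powRD; last by apply/implyP; rewrite (gt_eqF w0).
  by rewrite (addrC 1) subrK -Hhom ?ltW// scalerA divff ?scale1r ?gt_eqF.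
by rewrite Hw mulrAC mulfK.
Qed.

(** After division by [w], the argument on the left is the convex combination of [w1^-1 *: z1] and
    [w2^-1 *: z2] with weights [l = t * w1 / w] and [1 - l = (1 - t) * w2 / w]. Convexity of [H]
    there, multiplied by [w], is the claim. *)
Lemma convex_perspective (R : realType) (V : lmodType R) (H : V -> R)
    (t : {i01 R}) (w1 w2 : R) (z1 z2 : V)
    (w := t%:num * w1 + t%:num.~ * w2) :
  convex_function setT H -> 0 < w1 -> 0 < w2 ->
  w * H (w^-1 *: (t%:num *: z1 + t%:num.~ *: z2)) <=
  t%:num * (w1 * H (w1^-1 *: z1)) + t%:num.~ * (w2 * H (w2^-1 *: z2)).
Proof.
move=> Hconv w10 w20; have w0 : 0 < w by exact: convR_gt0.
have [w1n0 w2n0 wn0] : [/\ w1 != 0, w2 != 0 & w != 0] by rewrite !gt_eqF.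
have t0 : 0 <= t%:num by exact: ge0.
have s0 : 0 <= t%:num.~ by rewrite onem_ge0// le1.
pose l := t%:num * w1 / w.
have lC : l.~ = t%:num.~ * w2 / w.
  by rewrite /l {1}/onem -{1}(divff wn0) -mulrBl /w addrAC subrr add0r.
have l0 : 0 <= l by rewrite divr_ge0 ?mulr_ge0// ltW.
have l1 : l <= 1 by rewrite -subr_ge0 -/(onem l) lC divr_ge0 ?mulr_ge0// ltW.
have Hle : H (l *: (w1^-1 *: z1) + l.~ *: (w2^-1 *: z2)) <=
    l * H (w1^-1 *: z1) + l.~ * H (w2^-1 *: z2).
  by apply: (Hconv (Itv01 l0 l1)); rewrite in_setT.
rewrite lC !scalerA in Hle.
have -> : w^-1 *: (t%:num *: z1 + t%:num.~ *: z2) =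
    (l / w1) *: z1 + (t%:num.~ * w2 / w / w2) *: z2.
  by rewrite scalerDr !scalerA; congr (_ *: _ + _ *: _); rewrite /l; field;
    rewrite ?w1n0 ?w2n0.
have <- : w * (l * H (w1^-1 *: z1) + t%:num.~ * w2 / w * H (w2^-1 *: z2)) =
    t%:num * (w1 * H (w1^-1 *: z1)) + t%:num.~ * (w2 * H (w2^-1 *: z2)).
  by rewrite /l; field.
exact: ler_wpM2l (ltW w0) _ _ Hle.
Qed.

Theorem proposition2p3 (R : realType) (N : nat) (p : R) (H : 'rV[R]_N -> R)
    (hp : 1 < p)
    (H_ge0 : forall z, 0 <= H z)
    (H_convex : convex_function setT H)
    (H_hom : positively_homogeneous p H)
    (beta : R) (beta_gt0 : 0 < beta) (beta_le : beta <= p - 1) :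
  @convex_function R (R^o * 'rV[R]_N)%type (`]0, +oo[ `*` setT)
    (fun z => H z.2 / z.1 `^ beta).
Proof.
have p1 : 0 < p - 1 by rewrite subr_gt0.
have bn0 : beta != 0 by rewrite gt_eqF.
have pn0 : p - 1 != 0 by rewrite gt_eqF.
move=> t [m1 z1] [m2 z2]; rewrite !inE/= => -[+ _] [+ _] /=.
rewrite !in_itv/= !andbT => m10 m20.
pose m : R := t%:num * m1 + t%:num.~ * m2.
(* Convex combinations of pairs compute componentwise, so this holds by conversion. *)
change (H (t%:num *: z1 + t%:num.~ *: z2) / m `^ beta <=
  t%:num * (H z1 / m1 `^ beta) + t%:num.~ * (H z2 / m2 `^ beta)).
pose g := beta / (p - 1).
set w1 := m1 `^ g; set w2 := m2 `^ g.
have w10 : 0 < w1 by exact: powR_gt0.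
have w20 : 0 < w2 by exact: powR_gt0.
pose w := t%:num * w1 + t%:num.~ * w2.
have w0 : 0 < w by exact: convR_gt0.
have m0 : 0 < m by exact: convR_gt0.
have wE x : (x `^ g) `^ (p - 1) = x `^ beta by rewrite -powRrM divfK.
have gV (x : R) : 0 <= x -> (x `^ g) `^ g^-1 = x.
  by move=> x0; rewrite -powRrM divff ?powRr1// mulf_neq0 ?invr_neq0.
have g1 : 1 <= g^-1 by rewrite invf_ge1 ?ler_pdivrMr ?mul1r ?divr_gt0.
have wm : w `^ g^-1 <= m.
  rewrite /m -(gV m1 (ltW m10)) -(gV m2 (ltW m20)).
  by apply: (convex_powR g1 t); rewrite inE/= in_itv/= andbT ltW.
(* Raise [wm] to the power [beta], using [g^-1 * beta = p - 1]. *)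
have wb : w `^ (p - 1) <= m `^ beta.
  have := ge0_ler_powR (ltW beta_gt0) (powR_ge0 _ _) (ltW m0) wm.
  by rewrite -powRrM invf_div divfK.
(* The smaller denominator gives the larger quotient because [H] is nonnegative. *)
apply: (@le_trans _ _ (H (t%:num *: z1 + t%:num.~ *: z2) / w `^ (p - 1))).
  by rewrite ler_wpM2l// lef_pV2 ?posrE ?powR_gt0//.
(* All three quotients become perspectives, at [w], [w1] and [w2]. *)
rewrite -(perspective_homogeneous _ H_hom w0) -(wE m1) -(wE m2).
rewrite -!(perspective_homogeneous _ H_hom)//.
exact: convex_perspective.
Qed.
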